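(* Let $\mathcal{T}$ be a triangulated category with suspension functor $\Sigma$, and let $X$ and $Y$ be objects of $\mathcal{T}$. Suppose $R$ is a graded-commutative ring acting centrally on $\mathcal{T}$ such that the $R$-module $\operatorname{Hom}_{\mathcal{T}}^*(X,X)$ is eventually Noetherian of finite length, and suppose that $\operatorname{thick}_{\mathcal{T}}(X)$ is either a left or a right Auslander subcategory of $\mathcal{T}$. Let $r_1,\dots,r_c$ be a sequence of positive degree homogeneous elements of $R$ reducing the complexity of $X$, where $c=\operatorname{cx}_{\mathcal{T}}X$. Then the following are equivalent: (i) There exists an integer $n\in\mathbb{Z}$ such that $\operatorname{Hom}_{\mathcal{T}}(Y,\Sigma^iX)=0$ for $n\le i\le n+|r_1|+\cdots+|r_c|-c$. (ii) $\operatorname{Hom}_{\mathcal{T}}(Y,\Sigma^iX)=0$ for all $i\in\mathbb{Z}$.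
   Context: Central actions. For objects $X,Y$ of a triangulated category $\mathcal{T}$, put $\operatorname{Hom}_{\mathcal{T}}^*(X,Y)=\bigoplus_{i\in\mathbb{Z}}\operatorname{Hom}_{\mathcal{T}}(X,\Sigma^iY)$ and $\operatorname{Hom}_{\mathcal{T}}^{\ge n}(X,Y)=\bigoplus_{i\ge n}\operatorname{Hom}_{\mathcal{T}}(X,\Sigma^iY)$. The graded center $Z^*(\mathcal{T})$ has as its degree $n$ component the set of natural transformations $f:\operatorname{Id}\to\Sigma^n$ with $f_{\Sigma X}=(-1)^n\Sigma f_X$ for all objects $X$. A graded-commutative ring is a graded ring $R=\bigoplus_{i\ge 0}R_i$ with $r_1r_2=(-1)^{|r_1||r_2|}r_2r_1$ for homogeneous $r_1,r_2$. $R$ acts centrally on $\mathcal{T}$ if there is a (given) graded ring homomorphism $R\to Z^*(\mathcal{T})$; it induces graded ring homomorphisms $\varphi_X:R\to\operatorname{Hom}_{\mathcal{T}}^*(X,X)$ for each object $X$, and $\operatorname{Hom}_{\mathcal{T}}^*(X,Y)$ becomes an $R$-module via $\varphi_X$ or, equivalently up to the sign $(-1)^{|r||f|}$, via $\varphi_Y$. Finiteness. $\operatorname{Hom}_{\mathcal{T}}^*(X,Y)$ is eventually Noetherian of finite length (over $R$) if there is $n_0\in\mathbb{Z}$ such that the $R$-module $\operatorname{Hom}_{\mathcal{T}}^{\ge n_0}(X,Y)$ is Noetherian and $\ell_{R_0}(\operatorname{Hom}_{\mathcal{T}}(X,\Sigma^nY))<\infty$ for every $n\ge n_0$, where $\ell_{R_0}$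 denotes length over $R_0$. Complexity. $\operatorname{cx}_{\mathcal{T}}(X,Y)$ is the Krull dimension of $\operatorname{Hom}_{\mathcal{T}}^*(X,Y)$ as a module over $R^{\mathrm{ev}}=\bigoplus_{i\ge0}R_{2i}$, and $\operatorname{cx}_{\mathcal{T}}X=\operatorname{cx}_{\mathcal{T}}(X,X)$. When $\operatorname{Hom}_{\mathcal{T}}^*(X,Y)$ is eventually Noetherian of finite length, this number is finite and equals the infimum of all integers $t\ge 0$ for which there is a real number $a$ with $\ell_{R_0}(\operatorname{Hom}_{\mathcal{T}}(X,\Sigma^nY))\le an^{t-1}$ for $n\gg0$; this is the value meant here. Koszul objects. For a homogeneous $r\in R$, the Koszul object $X/\!\!/r$ is defined (up to isomorphism) by a distinguished triangle $X\xrightarrow{\varphi_X(r)}\Sigma^{|r|}X\to X/\!\!/r\to\Sigma X$. Inductively, $X/\!\!/(r_1,\dots,r_i)=(X/\!\!/(r_1,\dots,r_{i-1}))/\!\!/r_i$. Reducing complexity. If $\operatorname{Hom}_{\mathcal{T}}^*(X,X)$ is eventually Noetherian of finite length and $c=\operatorname{cx}_{\mathcal{T}}X$, a sequence $r_1,\dots,r_c$ of homogeneous elements of $R$ of positive degree reduces the complexity of $X$ if $\operatorname{cx}_{\mathcal{T}}X/\!\!/(r_1,\dots,r_i)=c-i$ for $1\le i\le c$ (for $c=0$ the sequence is empty). Thick and Auslander subcategories. A thick subcategory is a full triangulated subcategory closed under direct summands; $\operatorname{thick}_{\mathcal{T}}(X)$ is the smallest thick subcategory containing $X$. $\operatorname{Hom}_{\mathcal{T}}^*(X,Y)$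 is eventually zero if $\operatorname{Hom}_{\mathcal{T}}(X,\Sigma^nY)=0$ for $n\gg0$. A full subcategory $\mathcal{C}$ of $\mathcal{T}$ is a left Auslander subcategory if for every $X\in\mathcal{C}$ there is an integer $d_X$, depending only on $X$, such that whenever $\operatorname{Hom}_{\mathcal{T}}^*(X,Y)$ is eventually zero for some $Y\in\mathcal{T}$, then $\operatorname{Hom}_{\mathcal{T}}(X,\Sigma^nY)=0$ for $n\ge d_X$. Dually, $\mathcal{C}$ is a right Auslander subcategory if for every $X\in\mathcal{C}$ there is an integer $d_X$, depending only on $X$, such that whenever $\operatorname{Hom}_{\mathcal{T}}^*(Y,X)$ is eventually zero for some $Y\in\mathcal{T}$, then $\operatorname{Hom}_{\mathcal{T}}(Y,\Sigma^nX)=0$ for $n\ge d_X$. *)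

(* Defs.v *)
From mathcomp Require Import all_boot all_order all_algebra.
From mathcomp Require Import classical_sets Rstruct.

Set Implicit Arguments.
Unset Strict Implicit.
Unset Printing Implicit Defensive.

Import Order.TTheory GRing.Theory Num.Theory.
Local Open Scope classical_set_scope.
Local Open Scope ring_scope.

Declare Scope cat_scope.
Delimit Scope cat_scope with cat.
Local Open Scope cat_scope.

Record preaddCat := PreaddCat {
  obj :> Type;
  hom : obj -> obj -> zmodType;
  idm : forall A, hom A A;
  mcomp : forall A B C, hom B C -> hom A B -> hom A C;
  compA : forall A B C D (h : hom C D) (g : hom B C) (f : hom A B),
    mcomp h (mcomp g f) = mcomp (mcomp h g) f;
  comp1m : forall A B (f : hom A B), mcomp (idm B) f = f;
  compm1 : forall A B (f : hom A B), mcomp f (idm A) = f;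
  compDl : forall A B C (g g' : hom B C) (f : hom A B),
    mcomp (g + g') f = mcomp g f + mcomp g' f;
  compDr : forall A B C (g : hom B C) (f f' : hom A B),
    mcomp g (f + f') = mcomp g f + mcomp g f'
}.

Arguments idm {p} A.
Notation "g ∘ f" := (mcomp g f) (at level 40, left associativity) : cat_scope.

Definition is_iso (C : preaddCat) (A B : C) (f : hom A B) : Prop :=
  exists g : hom B A, g ∘ f = idm A /\ f ∘ g = idm B.

Definition is_zero_obj (C : preaddCat) (Z : C) : Prop := idm Z = 0.

Definition is_biproduct (C : preaddCat) (A B S : C)
    (iA : hom A S) (iB : hom B S) (pA : hom S A) (pB : hom S B) : Prop :=
  [/\ pA ∘ iA = idm A, pB ∘ iB = idm B, pA ∘ iB = 0, pB ∘ iA = 0 &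
      iA ∘ pA + iB ∘ pB = idm S].

Definition direct_summand (C : preaddCat) (A S : C) : Prop :=
  exists (B : C) (iA : hom A S) (iB : hom B S) (pA : hom S A) (pB : hom S B),
    is_biproduct iA iB pA pB.

Record additiveCat := AdditiveCat {
  addcat :> preaddCat;
  has_zero_obj : exists Z : addcat, is_zero_obj Z;
  has_biproducts : forall A B : addcat,
    exists (S : addcat) (iA : hom A S) (iB : hom B S)
           (pA : hom S A) (pB : hom S B), is_biproduct iA iB pA pB
}.

Record addEndofunctor (C : preaddCat) := AddEndofunctor {
  fobj :> C -> C;
  fmap : forall A B : C, hom A B -> hom (fobj A) (fobj B);
  fmap1 : forall A : C, fmap (idm A) = idm (fobj A);
  fmapM : forall (A B D : C) (g : hom B D) (f : hom A B),
    fmap (g ∘ f) = fmap g ∘ fmap f;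
  fmapD : forall (A B : C) (f g : hom A B), fmap (f + g) = fmap f + fmap g
}.

(* The suspension is an autoequivalence, given with a quasi-inverse [desusp];
   a strict automorphism is the case where [susp_unit] and [susp_counit] are
   identities. *)
Record triangulatedCat := TriangulatedCat {
  tcat :> additiveCat;
  susp : addEndofunctor tcat;
  desusp : addEndofunctor tcat;
  susp_unit : forall A : tcat, hom A (desusp (susp A));
  susp_unit_iso : forall A, is_iso (susp_unit A);
  susp_unit_nat : forall (A B : tcat) (f : hom A B),
    fmap desusp (fmap susp f) ∘ susp_unit A = susp_unit B ∘ f;
  susp_counit : forall A : tcat, hom (susp (desusp A)) A;
  susp_counit_iso : forall A, is_iso (susp_counit A);
  susp_counit_nat : forall (A B : tcat) (f : hom A B),
    susp_counit B ∘ fmap susp (fmap desusp f) = f ∘ susp_counit A;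
  dist : forall A B C : tcat, hom A B -> hom B C -> hom C (susp A) -> Prop;
  dist_iso : forall (A B C A' B' C' : tcat)
      (f : hom A B) (g : hom B C) (h : hom C (susp A))
      (f' : hom A' B') (g' : hom B' C') (h' : hom C' (susp A'))
      (a : hom A A') (b : hom B B') (c : hom C C'),
    is_iso a -> is_iso b -> is_iso c ->
    b ∘ f = f' ∘ a -> c ∘ g = g' ∘ b -> fmap susp a ∘ h = h' ∘ c ->
    dist f g h -> dist f' g' h';
  dist_id : forall A Z : tcat, is_zero_obj Z ->
    dist (idm A) (0 : hom A Z) (0 : hom Z (susp A));
  dist_cone : forall (A B : tcat) (f : hom A B),
    exists (C : tcat) (g : hom B C) (h : hom C (susp A)), dist f g h;
  dist_rot : forall (A B C : tcat)
      (f : hom A B) (g : hom B C) (h : hom C (susp A)),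
    dist f g h <-> dist g h (- fmap susp f);
  dist_mor : forall (A B C A' B' C' : tcat)
      (f : hom A B) (g : hom B C) (h : hom C (susp A))
      (f' : hom A' B') (g' : hom B' C') (h' : hom C' (susp A'))
      (a : hom A A') (b : hom B B'),
    dist f g h -> dist f' g' h' -> b ∘ f = f' ∘ a ->
    exists c : hom C C', c ∘ g = g' ∘ b /\ fmap susp a ∘ h = h' ∘ c;
  dist_oct : forall (A B C U V W : tcat) (f : hom A B) (g : hom B C)
      (i : hom B U) (j : hom U (susp A))
      (k : hom C V) (l : hom V (susp B))
      (m : hom C W) (n : hom W (susp A)),
    dist f i j -> dist g k l -> dist (g ∘ f) m n ->
    exists (u : hom U W) (v : hom W V),
      [/\ dist u v (fmap susp i ∘ l),
          u ∘ i = m ∘ g, n ∘ u = j, v ∘ m = k & l ∘ v = fmap susp f ∘ n]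
}.

Section Shift.
Variable T : triangulatedCat.
Implicit Types (A B X Y : T) (m n d : nat) (i : int).

Notation "'Σ'" := (susp T).

Definition suspn n A : T := iter n Σ A.

Definition shift i A : T :=
  match i with
  | Posz n => iter n Σ A
  | Negz n => iter n.+1 (desusp T) A
  end.

Fixpoint suspn_map n A B (f : hom A B) : hom (suspn n A) (suspn n B) :=
  if n is n'.+1 then fmap Σ (suspn_map n' f) else f.

(* The canonical identifications Σ^n Σ A = Σ Σ^n A and
   Σ^m Σ^n A = Σ^(m+n) A; their components are identities, but the two objects
   are not convertible for a variable n (resp. m). *)
Fixpoint suspn_susp n A : hom (suspn n (Σ A)) (Σ (suspn n A)) :=
  if n is n'.+1 then fmap Σ (suspn_susp n' A) else idm (Σ A).

Fixpoint suspnD m n A : hom (suspn m (suspn n A)) (suspn (m + n) A) :=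
  if m is m'.+1 then fmap Σ (suspnD m' n A) else idm (suspn n A).

(* i + 1, by cases, so that [shift (succi i) A] computes. *)
Definition succi i : int :=
  match i with
  | Posz n => Posz n.+1
  | Negz 0 => Posz 0
  | Negz n.+1 => Negz n
  end.

Lemma succiE i : succi i = i + 1.
Proof.
case: i => [n|[|n]] //; first by rewrite -PoszD addn1.
by rewrite /= !NegzE -[n.+2]addn1 PoszD opprD addrNK.
Qed.

Lemma iter_succiE d i : iter d succi i = i + d%:Z.
Proof.
elim: d => [|d IHd]; first by rewrite addr0.
by rewrite iterS IHd succiE -addrA -PoszD addn1.
Qed.

Definition shiftS i A : hom (Σ (shift i A)) (shift (succi i) A) :=
  match i return hom (Σ (shift i A)) (shift (succi i) A) with
  | Posz n => idm (iter n.+1 Σ A)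
  | Negz 0 => susp_counit A
  | Negz n.+1 => susp_counit (iter n.+1 (desusp T) A)
  end.

(* The isomorphism Σ^d Σ^i A -> Σ^(i+d) A. *)
Fixpoint shiftD d i A : hom (suspn d (shift i A)) (shift (iter d succi i) A) :=
  if d is d'.+1 then shiftS (iter d' succi i) A ∘ fmap Σ (shiftD d' i A)
  else idm (shift i A).

Definition hom_zero A B : Prop := forall f : hom A B, f = 0.

(* Degree n component of the graded center Z^*(T). *)
Definition in_center n (f : forall A, hom A (suspn n A)) : Prop :=
  (forall A B (g : hom A B), f B ∘ g = suspn_map n g ∘ f A) /\
  (forall A, suspn_susp n A ∘ f (Σ A) =
     if odd n then - fmap Σ (f A) else fmap Σ (f A)).

Record thick_subcat (P : set T) : Prop := ThickSubcat {
  thick_zero : forall Z, is_zero_obj Z -> P Z;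
  thick_susp : forall A, P A -> P (Σ A);
  thick_desusp : forall A, P A -> P (desusp T A);
  thick_cone : forall A B C (f : hom A B) (g : hom B C) (h : hom C (Σ A)),
    dist f g h -> P A -> P B -> P C;
  thick_summand : forall A S, direct_summand A S -> P S -> P A
}.

Definition thick X : set T :=
  [set A | forall P : set T, thick_subcat P -> P X -> P A].

Definition eventually_zero X Y : Prop :=
  exists N : int, forall n : int, N <= n -> hom_zero X (shift n Y).

Definition left_auslander (P : set T) : Prop :=
  forall X, P X -> exists d : int, forall Y, eventually_zero X Y ->
    forall n : int, d <= n -> hom_zero X (shift n Y).

Definition right_auslander (P : set T) : Prop :=
  forall X, P X -> exists d : int, forall Y, eventually_zero Y X ->
    forall n : int, d <= n -> hom_zero Y (shift n X).

End Shift.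

(* A graded ring given by its homogeneous components; the [ecast]s transport
   along equalities of degrees. *)
Record gcRing := GcRing {
  gcomp :> nat -> zmodType;
  gone : gcomp 0;
  gmul : forall m n, gcomp m -> gcomp n -> gcomp (m + n);
  gmulA : forall m n p (x : gcomp m) (y : gcomp n) (z : gcomp p),
    ecast k (gcomp k) (addnA m n p) (gmul x (gmul y z)) = gmul (gmul x y) z;
  gmul1r : forall n (x : gcomp n), gmul gone x = x;
  gmulr1 : forall n (x : gcomp n), ecast k (gcomp k) (addn0 n) (gmul x gone) = x;
  gmulDl : forall m n (x x' : gcomp m) (y : gcomp n),
    gmul (x + x') y = gmul x y + gmul x' y;
  gmulDr : forall m n (x : gcomp m) (y y' : gcomp n),
    gmul x (y + y') = gmul x y + gmul x y';
  gmulC : forall m n (x : gcomp m) (y : gcomp n),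
    gmul x y = ecast k (gcomp k) (addnC n m)
                 (if odd (m * n) then - gmul y x else gmul y x)
}.

Definition homog (R : gcRing) : Type := {n : nat & R n}.
Definition deg (R : gcRing) (r : homog R) : nat := tag r.

(* A graded ring homomorphism R -> Z^*(T). *)
Record centralAction (R : gcRing) (T : triangulatedCat) := CentralAction {
  act :> forall n, R n -> forall A : T, hom A (suspn n A);
  act_center : forall n (r : R n), in_center (act r);
  actD : forall n (r s : R n) (A : T), act (r + s) A = act r A + act s A;
  act1 : forall A : T, act (gone R) A = idm A;
  actM : forall m n (r : R m) (s : R n) (A : T),
    act (gmul r s) A = suspnD m n A ∘ act r (suspn n A) ∘ act s A
}.

Section Complexity.
Variables (R : gcRing) (T : triangulatedCat) (phi : centralAction R T).
Implicit Types (X Y K : T).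

(* The action of R on Hom^*(X,Y) through phi_X: r of degree d sends
   f : X -> Σ^i Y to Σ^d f ∘ phi_X(r) : X -> Σ^d X -> Σ^d Σ^i Y = Σ^(i+d) Y. *)
Definition ract X Y d (r : R d) (i : int) (f : hom X (shift i Y)) :
    hom X (shift (iter d succi i) Y) :=
  shiftD d i Y ∘ suspn_map d f ∘ phi d r X.

(* Elements of Hom^{>= n0}(X,Y) are the finitely supported families of
   morphisms X -> Σ^i Y vanishing in degrees i < n0. *)
Definition homge (n0 : int) X Y : set (forall i : int, hom X (shift i Y)) :=
  [set x | (forall i, i < n0 -> x i = 0) /\
           exists N : int, forall i, N <= i -> x i = 0].
Arguments homge n0 X Y : clear implicits.

(* In [submod_act], y is r x: every integer is i + d for a unique i. *)
Record is_submod (n0 : int) X Y (S : set (forall i : int, hom X (shift i Y))) :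
    Prop := IsSubmod {
  submod_sub : S `<=` homge n0 X Y;
  submod0 : S (fun=> 0);
  submodB : forall x y, S x -> S y -> S (fun i => x i - y i);
  submod_act : forall d (r : R d) x y, S x ->
    (forall i, y (iter d succi i) = ract r (x i)) -> S y
}.

Definition noetherian_homge (n0 : int) X Y : Prop :=
  forall S : nat -> set (forall i : int, hom X (shift i Y)),
    (forall k, is_submod n0 (S k)) -> (forall k, S k `<=` S k.+1) ->
    exists N, forall k, (N <= k)%N -> S k = S N.

Record is_submod0 X Y (n : int) (U : set (hom X (shift n Y))) : Prop :=
    IsSubmod0 {
  submod00 : U 0;
  submod0B : forall f g, U f -> U g -> U (f - g);
  submod0_act : forall (r : R 0%N) f, U f -> U (ract r f)
}.

Definition has_chain X Y (n : int) (l : nat) : Prop :=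
  exists U : nat -> set (hom X (shift n Y)),
    (forall k, (k <= l)%N -> is_submod0 (U k)) /\
    (forall k, (k < l)%N -> U k `<` U k.+1).

(* The R_0-module Hom(X, Σ^n Y) has (finite) length l, the length of a module
   being the supremum of the lengths of strict chains of submodules. *)
Definition is_length X Y (n : int) (l : nat) : Prop :=
  has_chain X Y n l /\ forall k, has_chain X Y n k -> (k <= l)%N.

Definition ev_noetherian_finite_length X Y : Prop :=
  exists n0 : int, noetherian_homge n0 X Y /\
    forall n : int, n0 <= n -> exists l, is_length X Y n l.

(* The real numbers are Stdlib's, with the MathComp structures of Rstruct;
   the exponent t - 1 is an integer, equal to -1 for t = 0. *)
Definition growth_le X Y (t : nat) : Prop :=
  exists (a : Rdefinitions.R) (N : nat), forall n : nat, (N <= n)%N ->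
    exists2 l, is_length X Y n l & l%:R <= a * n%:R ^ (t%:Z - 1).

(* cx(X,Y) = c, an infimum of natural numbers being a minimum. *)
Definition is_cx X Y (c : nat) : Prop :=
  growth_le X Y c /\ forall t, growth_le X Y t -> (c <= t)%N.

Definition is_koszul1 X (r : homog R) K : Prop :=
  exists (g : hom (suspn (deg r) X) K) (h : hom K (susp T X)),
    dist (phi _ (tagged r) X) g h.

(* K is (isomorphic to) X//(r_1,...,r_i). *)
Fixpoint is_koszul X (rs : seq (homog R)) K : Prop :=
  if rs is r :: rs' then exists2 X', is_koszul1 X r X' & is_koszul X' rs' K
  else exists f : hom X K, is_iso f.

(* A Koszul object exists and is unique up to isomorphism, so quantifying over
   all its representatives K in [red_cx] states a property of X//(r_1,...,r_i). *)
Record reduces_complexity X (c : nat) (rs : seq (homog R)) : Prop :=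
    ReducesComplexity {
  red_size : size rs = c;
  red_pos : all (fun r => 0 < deg r)%N rs;
  red_cx : forall i K, (1 <= i <= c)%N -> is_koszul X (take i rs) K ->
    is_cx K K (c - i)
}.

End Complexity.

(* Main.v *)
(** If [K = X//(r_1,...,r_c)], then [K] has complexity [0], so that
    [Hom(K, Σ^n K) = 0] for [n >> 0].  As [K] lies in [thick X], the Auslander
    bound [d_K] also applies to the shifts of [K], which are uniform in it: it
    forces [Hom(K, K) = 0], that is [K = 0].  Now climb back from [K] to [X]: if
    all [Hom(Y, Σ^i (X//r))] vanish, then [Hom(Y, Σ^i X)] is periodic in [i] with
    period [|r|], so it vanishes as soon as it does for [|r|] consecutive values
    of [i]; and a window of [m] zeros for [X] is a window of [m - |r| + 1] zeros
    for [X//r]. *)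
From mathcomp Require Import all_boot all_order all_algebra.
From mathcomp Require Import boolp classical_sets Rstruct zify.
Require Import Defs.
Import Order.TTheory GRing.Theory Num.Theory.
Local Open Scope ring_scope.
Local Open Scope cat_scope.

Set Implicit Arguments.
Unset Strict Implicit.
Unset Printing Implicit Defensive.

(** * Zero morphisms and additive functors *)

Section Preadditive.
Variable C : preaddCat.
Implicit Types A B D : C.

Lemma comp0m A B D (f : hom A B) : (0 : hom B D) ∘ f = 0.
Proof. by apply: (@addIr _ ((0 : hom B D) ∘ f)); rewrite -compDl !add0r. Qed.

Lemma compm0 A B D (g : hom B D) : g ∘ (0 : hom A B) = 0.
Proof. by apply: (@addIr _ (g ∘ (0 : hom A B))); rewrite -compDr !add0r. Qed.

Lemma compmN A B D (g : hom B D) (f : hom A B) : g ∘ (- f) = - (g ∘ f).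
Proof. by apply/eqP; rewrite -addr_eq0 -compDr addNr compm0. Qed.

Lemma iso_comp_eq0 A B D (b : hom B D) (f : hom A B) :
  is_iso b -> b ∘ f = 0 -> f = 0.
Proof. by case=> g [gb _] bf0; rewrite -[f]comp1m -gb -compA bf0 compm0. Qed.

Lemma comp_iso_eq0 A B D (b : hom A B) (f : hom B D) :
  is_iso b -> f ∘ b = 0 -> f = 0.
Proof. by case=> g [_ bg] fb0; rewrite -[f]compm1 -bg compA fb0 comp0m. Qed.

Variable F : addEndofunctor C.

Lemma fmap0 A B : fmap F (0 : hom A B) = 0.
Proof. by apply: (@addIr _ (fmap F (0 : hom A B))); rewrite -fmapD !add0r. Qed.

End Preadditive.

(** * Vanishing of Hom under suspension, shifts and triangles *)

Section Vanishing.
Variable T : triangulatedCat.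
Implicit Types (A B C W Y X K : T) (i j : int).
Notation "'Σ'" := (susp T).
Notation "'D'" := (desusp T).

Lemma hom_zero_isor W A B (f : hom A B) :
  is_iso f -> hom_zero W A <-> hom_zero W B.
Proof.
case=> g [gf fg]; split=> z u.
  by rewrite -[u]comp1m -fg -compA (z (g ∘ u)) compm0.
by rewrite -[u]comp1m -gf -compA (z (f ∘ u)) compm0.
Qed.

Lemma hom_zero_isol W V A (f : hom W V) :
  is_iso f -> hom_zero W A <-> hom_zero V A.
Proof.
case=> g [gf fg]; split=> z u.
  by rewrite -[u]compm1 -fg compA (z (u ∘ f)) comp0m.
by rewrite -[u]compm1 -gf compA (z (u ∘ g)) comp0m.
Qed.

Lemma susp_eq0 A B (f : hom A B) : fmap Σ f = 0 -> f = 0.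
Proof.
move=> f0; apply: (iso_comp_eq0 (susp_unit_iso B)).
by rewrite -susp_unit_nat f0 fmap0 comp0m.
Qed.

Lemma desusp_eq0 A B (f : hom A B) : fmap D f = 0 -> f = 0.
Proof.
move=> f0; apply: (comp_iso_eq0 (susp_counit_iso A)).
by rewrite -susp_counit_nat f0 fmap0 compm0.
Qed.

Lemma hom_zero_susp W A : hom_zero (Σ W) (Σ A) <-> hom_zero W A.
Proof.
split=> z f; first exact/susp_eq0/z.
(* Composing [fmap D f] with the units turns it into a map [W -> A], so no preimage of [f] under [Σ]
   has to be built. *)
apply: desusp_eq0; apply: (comp_iso_eq0 (susp_unit_iso W)).
have [g gg] := susp_unit_iso A.
apply: (@iso_comp_eq0 _ _ _ _ g); last exact: z.
by exists (susp_unit A); case: gg.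
Qed.

Lemma hom_zero_desuspr W A : hom_zero W (D A) <-> hom_zero (Σ W) A.
Proof. by rewrite -hom_zero_susp; exact: hom_zero_isor (susp_counit_iso A). Qed.

Lemma hom_zero_suspr W A : hom_zero W (Σ A) <-> hom_zero (D W) A.
Proof.
by rewrite -(hom_zero_susp (D W)) (hom_zero_isol _ (susp_counit_iso W)).
Qed.

(** Once the whole shift sits on the first argument, isomorphisms and triangles in the second one
    can be applied without being shifted themselves. *)
Lemma hom_zero_shift W A i :
  hom_zero W (shift i A) <-> hom_zero (shift (- i) W) A.
Proof.
have iterΣ n V : hom_zero V (iter n Σ A) <-> hom_zero (iter n D V) A.
  by elim: n V => //= n IHn V; rewrite hom_zero_suspr IHn -iterSr.
have iterD n V : hom_zero V (iter n D A) <-> hom_zero (iter n Σ V) A.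
  by elim: n V => //= n IHn V; rewrite hom_zero_desuspr IHn -iterSr.
by case: i => [[|n]|n]; [|apply: iterΣ|apply: iterD].
Qed.

Lemma hom_zero_shift_iso Y A B i (f : hom A B) :
  is_iso f -> hom_zero Y (shift i A) <-> hom_zero Y (shift i B).
Proof. by move=> isof; rewrite !hom_zero_shift; apply: hom_zero_isor isof. Qed.

Lemma hom_zero_shift_susp Y A i :
  hom_zero Y (shift i (Σ A)) <-> hom_zero Y (shift (i + 1) A).
Proof.
rewrite -succiE; case: i => [n|n]; first by rewrite /= -iterSr.
(* The innermost [D] is split off so that the unit cancels it against [Σ]. *)
have -> : shift (Negz n) (Σ A) = shift (- n%:Z) (D (Σ A)).
  by case: n => // n; rewrite -NegzE /shift iterSr.
rewrite -(hom_zero_shift_iso _ _ (susp_unit_iso A)).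
by case: n.
Qed.

Lemma hom_zero_shift_desusp Y A i :
  hom_zero Y (shift i (D A)) <-> hom_zero Y (shift (i - 1) A).
Proof.
rewrite -(hom_zero_shift_iso _ _ (susp_counit_iso A)).
by rewrite hom_zero_shift_susp subrK.
Qed.

Lemma hom_zero_shift_suspn Y A i n :
  hom_zero Y (shift i (suspn n A)) <-> hom_zero Y (shift (i + n%:Z) A).
Proof.
elim: n i => [|n IHn] i; first by rewrite addr0.
by rewrite hom_zero_shift_susp IHn -addrA -PoszD.
Qed.

Lemma hom_zero_shiftD Y A i j :
  hom_zero Y (shift i (shift j A)) <-> hom_zero Y (shift (i + j) A).
Proof.
case: j => [n|n]; first exact: hom_zero_shift_suspn.
have iterD m k :
    hom_zero Y (shift k (iter m D A)) <-> hom_zero Y (shift (k - m%:Z) A).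
  elim: m k => [|m IHm] k; first by rewrite subr0.
  by rewrite hom_zero_shift_desusp IHm -addrA -opprD -PoszD.
exact: iterD n.+1 i.
Qed.

(** Exactness of Hom(W, -) at [B]: as [g ∘ u = 0], the map [u] extends to a morphism from the
    triangle W -> 0 -> ΣW to B -> C -> ΣA. Its third component ΣW -> ΣA vanishes, which forces Σu =
    0. *)
Lemma hom_zero_dist W A B C (f : hom A B) (g : hom B C) (h : hom C (Σ A)) :
  dist f g h -> hom_zero W A -> hom_zero W C -> hom_zero W B.
Proof.
move=> tri zA zC u; have [Z Z0] := has_zero_obj T.
have triW : dist (0 : hom W Z) (0 : hom Z (Σ W)) (- fmap Σ (idm W)).
  exact/(dist_rot (idm W))/dist_id.
have sq : (0 : hom Z C) ∘ (0 : hom W Z) = g ∘ u by rewrite comp0m (zC (g ∘ u)).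
have [v [_]] := dist_mor triW (iffLR (dist_rot _ _ _) tri) sq.
rewrite (iffRL (hom_zero_susp W A) zA v).
rewrite fmap1 compmN compm1 compm0 => /eqP.
by rewrite oppr_eq0 => /eqP/susp_eq0.
Qed.

Lemma hom_zero_shift_dist Y A B C (f : hom A B) (g : hom B C)
    (h : hom C (Σ A)) i : dist f g h ->
  hom_zero Y (shift i A) -> hom_zero Y (shift i C) -> hom_zero Y (shift i B).
Proof. by rewrite !hom_zero_shift; apply: hom_zero_dist. Qed.

Lemma hom_zero_of_zero_obj Y K i : is_zero_obj K -> hom_zero Y (shift i K).
Proof.
by move=> K0; rewrite hom_zero_shift => f; rewrite -[f]comp1m K0 comp0m.
Qed.

Lemma thick_iso (P : set T) A B (f : hom A B) :
  thick_subcat P -> is_iso f -> P A -> P B.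
Proof.
move=> thP [g [gf fg]] PA; have [Z Z0] := has_zero_obj T.
apply: (thick_summand thP _ PA); exists Z, g, 0, f, 0; split=> //.
- by rewrite comp0m -Z0.
- exact: compm0.
- exact: comp0m.
- by rewrite comp0m addr0.
Qed.

Lemma auslander_zero_obj (P : set T) K :
  left_auslander P \/ right_auslander P -> P K -> eventually_zero K K ->
  is_zero_obj K.
Proof.
move=> aus PK [N zN]; suff: hom_zero K (shift 0 K) by apply.
case: aus => /(_ _ PK)[d zd].
(* Against this test object, degree [d] is Hom(K, K). *)
- have ev : eventually_zero K (shift (- d) K).
    exists (N + d) => n ?; rewrite hom_zero_shiftD; apply: zN; lia.
  by have := zd _ ev d (lexx d); rewrite hom_zero_shiftD subrr.
(* In the first argument the shift enters with the opposite sign. *)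
- have ev : eventually_zero (shift d K) K.
    exists (N + d) => n ?; rewrite -[d]opprK -hom_zero_shift.
    rewrite hom_zero_shiftD; apply: zN; lia.
  have := zd _ ev d (lexx d).
  by rewrite -{1}[d]opprK -hom_zero_shift hom_zero_shiftD addNr.
Qed.

End Vanishing.

Lemma periodic_int (P : int -> Prop) (d : nat) (n : int) : (0 < d)%N ->
  (forall i, P i <-> P (i + d%:Z)) ->
  (forall i, n <= i < n + d%:Z -> P i) -> forall i, P i.
Proof.
move=> d_gt0 per win i.
have perM k j : P j <-> P (j + k%:Z * d%:Z).
  elim: k j => [|k IHk] j; first by rewrite mul0r addr0.
  by rewrite per IHk -addrA -[k.+1]add1n PoszD mulrDl mul1r.
have d0 : d%:Z != 0 by rewrite -lt0n.
(* Euclidean division of [i - n] by [d] moves [i] into the window by a multiple of the period. *)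
have := divz_eq (i - n) d%:Z; have := ltz_pmod (i - n) (_ : 0 < d%:Z).
have := modz_ge0 (i - n) d0; move: ((i - n) %% d%:Z)%Z => r r_ge0 /(_ d_gt0) lt_rd.
have Pr : P (n + r) by apply: win; lia.
move/(canRL (subrK n)) => ->; case: ((i - n) %/ d%:Z)%Z => k.
  by rewrite -addrA addrC [r + n]addrC -perM.
by rewrite (perM k.+1) NegzE mulNr addrC !addrA subrr add0r addrC.
Qed.

(** * Koszul objects and windows of zeros *)

Section Koszul.
Variables (R : gcRing) (T : triangulatedCat) (phi : centralAction R T).
Implicit Types (X Y K : T) (rs : seq (homog R)).

(** For [t = 0] the lengths are at most a/n. Beyond [M] one has n > |a|, so this is below 1 and the
    length is 0. *)
Lemma growth_le0_eventually_zero X Y : growth_le phi X Y 0 -> eventually_zero X Y.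
Proof.
case=> a [N len]; pose M := maxn N.+1 (Num.trunc `|a|).+1.
exists M%:Z; case=> // n; rewrite lez_nat geq_max => /andP[ltNn lt_an] f.
have [l [_ lmax] le_l] := len n (ltnW ltNn).
have n_gt0 : 0 < n%:R :> Rdefinitions.R by rewrite ltr0n (leq_ltn_trans _ ltNn).
have lt_a : a < n%:R.
  apply: le_lt_trans (ler_norm a) _; apply: lt_le_trans (truncnS_gt _) _.
  by rewrite ler_nat.
have l0 : l = 0%N.
  apply/eqP; rewrite -leqn0 -ltnS -(ltr_nat Rdefinitions.R).
  by apply: le_lt_trans le_l _; rewrite sub0r exprN1 ltr_pdivrMr ?mul1r.
(* A nonzero [f] would make the zero submodule and the whole module a strict chain of length 1. *)
apply: contrapT => f0; have /lmax : has_chain phi X Y n 1; last by rewrite l0.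
exists (fun k => if k is 0%N then [set 0]%classic else [set: _]%classic); split=> [[|k] _|[|k] //].
- split=> // [_ _ -> ->|r _ ->] /=; first exact: subrr.
  by rewrite /ract compm0 comp0m.
- by split.
- by move=> _; split=> // /(_ f I).
Qed.

Lemma koszul_exists X rs : exists K, is_koszul phi X rs K.
Proof.
elim: rs X => [|r rs IHrs] X.
  by exists X, (idm X), (idm X); rewrite comp1m.
have [X' [g [h tri]]] := dist_cone (phi _ (tagged r) X).
have [K kosK] := IHrs X'; exists K, X' => //.
by exists g, h.
Qed.

(** The generator [A] stays fixed while the induction replaces [X] by X//r. *)
Lemma koszul_thick X A rs K : thick A X -> is_koszul phi X rs K -> thick A K.
Proof.
elim: rs X => [|r rs IHrs] X thX /=.
  by case=> f isof P thP PA; apply: (thick_iso thP isof); exact: (thX P thP PA).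
case=> X' [g [h tri]]; apply: IHrs => P thP PA.
have PX : P X := thX P thP PA.
have PsuspX n : P (suspn n X) by elim: n => // n IHn; apply: (thick_susp thP).
exact: (thick_cone thP tri).
Qed.

(** Induction on [rs]: passing to X//r costs |r| - 1 zeros of the window, which is why each element
    contributes its degree minus one to the bound. *)
Lemma koszul_window X Y rs K (n : int) : all (fun r => 0 < deg r)%N rs ->
  is_koszul phi X rs K -> (forall i, hom_zero Y (shift i K)) ->
  (forall i : int, n <= i <= n + (\sum_(r <- rs) deg r)%N%:Z - (size rs)%:Z ->
     hom_zero Y (shift i X)) ->
  forall i, hom_zero Y (shift i X).
Proof.
elim: rs X n => [|r rs IHrs] X n /=.
  by move=> _ [f isof] zK _ i; rewrite (hom_zero_shift_iso _ _ isof).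
case/andP=> r_gt0 rs_gt0 [X' [g [h tri]] kosK] zK; rewrite big_cons => win.
have triS := iffLR (dist_rot _ _ _) tri.
have triSS := iffLR (dist_rot _ _ _) triS.
(* This guarantees that the window contains a full period of [deg r] values. *)
have le_size : (size rs <= \sum_(r <- rs) deg r)%N.
  elim: (rs) rs_gt0 => [|s ss IHss] /=; first by rewrite big_nil.
  by case/andP=> s_gt0 /IHss; rewrite big_cons; lia.
have zX' : forall i, hom_zero Y (shift i X').
  (* Degree [i] of [X'] lies between degrees i + |r| and i + 1 of [X]; the latter explains the start
     at [n - 1]. *)
  apply: (IHrs X' (n - 1)) => // i bnd.
  apply: (hom_zero_shift_dist triS).
    by rewrite -/(deg r) hom_zero_shift_suspn; apply: win; lia.
  by rewrite hom_zero_shift_susp; apply: win; lia.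
apply: (@periodic_int _ (deg r) n r_gt0) => [i|i bnd]; last by apply: win; lia.
rewrite -hom_zero_shift_suspn; split=> [zX|zSX].
  exact: (hom_zero_shift_dist tri).
(* In [triSS] the middle term is ΣX, so degree [i] of [X] is read there in degree [i - 1]. *)
rewrite -[i](subrK 1) -hom_zero_shift_susp.
apply: (hom_zero_shift_dist triSS); first exact: zX'.
by rewrite hom_zero_shift_susp subrK.
Qed.

End Koszul.

Theorem theorem3p3 (T : triangulatedCat) (X Y : T)
  (R : gcRing) (phi : centralAction R T)
  (hX : ev_noetherian_finite_length phi X X)
  (hA : left_auslander (thick X) \/ right_auslander (thick X))
  (c : nat) (hc : is_cx phi X X c)
  (rs : seq (homog R)) (hrs : reduces_complexity phi X c rs) :
  (exists n : int, forall i : int,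
     n <= i <= n + (\sum_(r <- rs) deg r)%N%:Z - c%:Z ->
     hom_zero Y (shift i X))
  <->
  (forall i : int, hom_zero Y (shift i X)).
Proof.
split=> [[n win]|z]; last by exists 0 => i _.
have [size_rs rs_gt0 cx_rs] := hrs.
have [K kosK] := koszul_exists phi X rs.
have K0 : is_zero_obj K.
  apply: (auslander_zero_obj hA).
    by apply: (koszul_thick _ kosK) => P.
  (* For [c = 0] the condition [cx_rs] is empty; then [K] is isomorphic to [X], and [hc] itself
     gives complexity 0. *)
  case: c hc size_rs cx_rs {hrs win} => [|m] [gX _] size_rs cx_rs.
    case: rs size_rs kosK {rs_gt0 cx_rs} => // _ [f isof].
    have [N zN] := growth_le0_eventually_zero gX.
    exists N => i leNi; rewrite -(hom_zero_shift_iso _ _ isof).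
    by rewrite -(hom_zero_isol _ isof); apply: zN.
  have [] := cx_rs m.+1 K; first by rewrite ltnS leqnn.
    by rewrite -size_rs take_size.
  by rewrite subnn => /growth_le0_eventually_zero.
apply: (koszul_window rs_gt0 kosK (n := n)) => [i|i].
  exact: hom_zero_of_zero_obj.
by rewrite size_rs; apply: win.
Qed.
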